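(* There is no finite non-commutative completely regular semigroup whose knit degree is equal to $1$.
   Context: A semigroup $S$ is completely regular if it is equipped with a unary operation $x\mapsto x^{-1}$ such that for all $x\in S$: $(x^{-1})^{-1}=x$, $xx^{-1}x=x$, and $x^{-1}x=xx^{-1}$. Equivalently, every element of $S$ lies in a subgroup of $S$. The center of $S$ is $Z(S)=\{x\in S: xy=yx \text{ for all } y\in S\}$. The commuting graph $\mathcal{G}(S)$ of a finite non-commutative semigroup $S$ is the simple graph with vertex set $S\setminus Z(S)$ in which two distinct vertices $x,y$ are adjacent if and only if $xy=yx$. A left path in $\mathcal{G}(S)$ is a path $x_1-x_2-\cdots-x_n$ in $\mathcal{G}(S)$ (pairwise distinct vertices, consecutive ones adjacent) such that $x_1\neq x_n$ and $x_1x_i=x_nx_i$ for all $i\in\{1,\ldots,n\}$; its length is $n-1$. If $\mathcal{G}(S)$ contains left paths, the knit degree of $S$ is the length of a shortest left path in $\mathcal{G}(S)$; otherwise the knit degree is undefined. *)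

(* Defs.v *)
From HB Require Import structures.
From mathcomp Require Import all_boot.

Set Implicit Arguments.
Unset Strict Implicit.
Unset Printing Implicit Defensive.

Local Open Scope group_scope.

#[short(type="finSemigroupType")]
HB.structure Definition FinSemigroup := {S of Finite S & Semigroup S}.

Section CommutingGraph.

Variable S : finSemigroupType.
Implicit Types (x y : S) (p : seq S).

Definition completely_regular : Prop :=
  exists inv : S -> S, forall x,
    [/\ inv (inv x) = x, x * inv x * x = x & inv x * x = x * inv x].

Definition center : {set S} := [set x | [forall y, x * y == y * x]].

Definition cgraph_vertices : {set S} := ~: center.

Definition cgraph_adj : rel S := fun x y =>
  [&& x \in cgraph_vertices, y \in cgraph_vertices, x != y & x * y == y * x].

(* As in path.v, a path is given by its first vertex x and the sequence p of
   the remaining ones; its length (number of edges) is therefore size p. *)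
Definition cgraph_path x p : bool :=
  [&& all [in cgraph_vertices] (x :: p), uniq (x :: p) & path cgraph_adj x p].

Definition left_path x p : bool :=
  [&& cgraph_path x p, x != last x p
    & all (fun y => x * y == last x p * y) (x :: p)].

(* The knit degree is a partial function of S, hence rendered as a relation:
   knit_degree_is k holds for no k when there are no left paths. *)
Definition knit_degree_is (k : nat) : Prop :=
  (exists x p, left_path x p /\ size p = k) /\
  (forall x p, left_path x p -> k <= size p).

End CommutingGraph.

Arguments completely_regular S : clear implicits.
Arguments center S : clear implicits.
Arguments cgraph_vertices S : clear implicits.
Arguments knit_degree_is S k : clear implicits.

(* Main.v *)
Require Import Defs.
From HB Require Import structures.
From mathcomp Require Import all_boot.

Local Open Scope group_scope.

(** A left path of length 1 is an edge [x - y] with [x * x = y * x] and [x * y = y * y]; as [x] and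
    [y] commute, all four products agree. Equal squares put [x] and [y] in one subgroup, where
    cancelling [y] in [x * y = y * y] gives [x = y], against distinctness. *)

Lemma completely_regular_sqr_inj (S : finSemigroupType) (x y : S) :
  completely_regular S -> x * x = y * y -> x * y = y * y -> x = y.
Proof.
case=> inv invP xxyy xyyy.
have [_ xVx xC] := invP x; have [_ yVy yC] := invP y.
have xE : inv x * (x * x) = x by rewrite mulgA xC.
have yE : y * y * inv y = y by rewrite -mulgA -yC mulgA.
(* With e = x^-1 x, both sides equal e y: e y = x^-1 y^2 = x^-1 x^2 = x, while
   y = x^2 y^-1 is fixed by e. *)
have eyx : inv x * (x * y) = x by rewrite xyyy -xxyy.
by rewrite -eyx -[in LHS]yE -xxyy !mulgA -(mulgA (inv x)) xE xxyy yE.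
Qed.

Theorem theorem6p3 :
  ~ exists S : finSemigroupType,
      [/\ ~ commutative (fun x y : S => (x * y)%g),
          completely_regular S
        & knit_degree_is S 1].
Proof.
case=> S [_ regS [[x [[|y [|z p]] [lp //= _]]] _]].
case/and3P: lp => /and3P[_ _ /= /andP[/and4P[_ _ _ /eqP xyC] _]] /eqP neq_xy.
case/and3P=> /eqP /= xx /eqP /= xy _.
(* Equality of squares is the chain [x * x = y * x = x * y = y * y], whose middle link is
   adjacency. *)
by apply: neq_xy; apply: completely_regular_sqr_inj => //=; rewrite xx -xyC.
Qed.
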